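(* Let $H$ be a graph on $k \geq 2$ vertices and let $U \subseteq V(H)$. Let $c \geq 1$ be an integer and let $G$ be any $c$-closed graph on $n$ vertices. Then the number of sets $S \subseteq V(G)$ such that $G[S]$ is a maximal $U$-clique prescribed blow-up of $H$ in $G$ is at most \[ n^{\max(c-1,1)\,k} \cdot \min\left\{3^{(c-1)k/3}n^{2k},\ 4^{(c+4)(c-1)k/2}n^{(2-2^{1-c})k}\right\}. \]
   Context: All graphs are finite, simple and undirected. A graph $G$ is $c$-closed (for an integer $c\ge 1$) if any two distinct non-adjacent vertices of $G$ have fewer than $c$ common neighbours. For $S\subseteq V(G)$, $G[S]$ denotes the induced subgraph. Given a graph $H$ with $V(H)=\{1,\dots,k\}$ and $U\subseteq V(H)$, a $U$-clique prescribed blow-up of $H$ is a graph $H'$ whose vertex set is partitioned into nonempty sets $V_1\sqcup\dots\sqcup V_k$ such that whenever $ij\in E(H)$ every vertex of $V_i$ is adjacent to every vertex of $V_j$, and for each $i\in U$ the set $V_i$ is a clique (no other adjacency or non-adjacency is required). $G[S]$ is a maximal $U$-clique prescribed blow-up of $H$ in $G$ if $G[S]$ is such a blow-up (for some partition) and there is no $S'$ with $S\subsetneq S'\subseteq V(G)$ such that $G[S']$ is such a blow-up. *)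

(* Defs.v *)
From mathcomp Require Export all_boot all_order all_algebra.
From mathcomp Require Export reals exp.

Set Implicit Arguments.
Unset Strict Implicit.
Unset Printing Implicit Defensive.

(* A finite simple undirected graph is a finType of vertices together with an
   adjacency relation e satisfying simple_graph e. *)
Definition simple_graph (T : finType) (e : rel T) : Prop :=
  symmetric e /\ irreflexive e.

Definition c_closed (c : nat) (T : finType) (e : rel T) : Prop :=
  forall x y : T, x != y -> ~~ e x y -> #|[set z | e x z && e y z]| < c.

Definition is_clique (T : finType) (e : rel T) (A : {set T}) : bool :=
  [forall x in A, forall y in A, (x != y) ==> e x y].

(* The parts V i need explicit indices, so this is not finset's [partition]. *)
Definition indexed_partition (k : nat) (T : finType)
    (V : {ffun 'I_k -> {set T}}) (S : {set T}) : bool :=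
  [&& [forall i, V i != set0],
      [forall i, forall j, (i != j) ==> [disjoint V i & V j]]
    & \bigcup_i V i == S].

(* The subgraph of (T, e) induced by S is a U-clique prescribed blow-up of
   (k, h).  All parts lie in S, so adjacency in the induced subgraph is e. *)
Definition blowup (k : nat) (h : rel 'I_k) (U : {set 'I_k})
    (T : finType) (e : rel T) (S : {set T}) : bool :=
  [exists V : {ffun 'I_k -> {set T}},
    [&& indexed_partition V S,
        [forall i, forall j, h i j ==>
           [forall x in V i, forall y in V j, e x y]]
      & [forall i in U, is_clique e (V i)]]].

Definition max_blowups (k : nat) (h : rel 'I_k) (U : {set 'I_k})
    (T : finType) (e : rel T) : {set {set T}} :=
  [set S | maxset (blowup h U e) S].

(* Main.v *)
(* In a maximal blow-up, a part V i that is not a clique has only neighbouring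
   parts with fewer than c vertices, since these consist of common neighbours of
   two nonadjacent vertices; by maximality the blow-up then contains all common
   neighbours of these parts.  If V i is a clique with at least c vertices, any
   maximal clique C containing it lies in the blow-up: a vertex of C and a vertex
   of a neighbouring part have V i among their common neighbours, hence are
   adjacent.  So the blow-up is recovered from one code per part, a code being
   either a set with fewer than c vertices or a maximal clique, and it remains to
   bound the number of maximal cliques.

   The quadratic bound deletes vertices v one at a time: a maximal clique K whose
   trace K \ v is no longer maximal gives a maximal clique in the common
   neighbourhood of v and some nonadjacent u, and Moon-Moser applies there.  The
   subquadratic bound is by induction on c, as the neighbourhood of a vertex of a
   (c+1)-closed graph is c-closed. *)
Require Import Defs.
From mathcomp Require Import zify ring lra.
Import Order.TTheory GRing.Theory Num.Theory.

Set Implicit Arguments.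
Unset Strict Implicit.
Unset Printing Implicit Defensive.


(** * Maximal cliques: relative closedness and counting recursions *)

Definition max_cliques (T : finType) (e : rel T) (S : {set T}) : {set {set T}} :=
  [set K | maxset (fun A => (A \subset S) && is_clique e A) K].

Definition common_nbr (T : finType) (e : rel T) (X : {set T}) : {set T} :=
  [set y | [forall x in X, e x y]].

(** Common neighbours are counted inside [S], so that the parameter can drop on passing to a
    neighbourhood. The value [c = 0] is allowed and makes [S] a clique. *)
Definition closed_in (c : nat) (T : finType) (e : rel T) (S : {set T}) : Prop :=
  forall x y, x \in S -> y \in S -> x != y -> ~~ e x y ->
    #|[set z in S | e x z && e y z]| < c.

Lemma is_cliqueP (T : finType) (e : rel T) (A : {set T}) :
  reflect {in A &, forall x y, x != y -> e x y} (is_clique e A).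
Proof.
apply: (iffP forall_inP) => [AP x y xA yA xy|AP x xA].
  by have /forall_inP/(_ y yA) := AP x xA; rewrite xy.
by apply/forall_inP => y yA; apply/implyP; apply: AP.
Qed.

Lemma card_bigcup_leq (T I : finType) (Z : {set I}) (F : I -> {set T}) :
  #|\bigcup_(i in Z) F i| <= \sum_(i in Z) #|F i|.
Proof.
apply: (big_ind2 (fun (A : {set T}) m => #|A| <= m)) => //; first by rewrite cards0.
move=> A m B p Am Bp; apply: leq_trans (leq_add Am Bp).
by rewrite cardsU leq_subr.
Qed.

Section MaximalCliques.

Variables (T : finType) (e : rel T).
Hypothesis graph_e : simple_graph e.

Local Notation MC := (max_cliques e).
Local Notation N := (common_nbr e).
Local Notation nbr u := (common_nbr e [set u]).

Let e_sym : symmetric e := graph_e.1.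
Let e_irr : irreflexive e := graph_e.2.

Lemma common_nbrP (X : {set T}) y : reflect {in X, forall x, e x y} (y \in N X).
Proof. by rewrite inE; apply: (iffP forall_inP). Qed.

Lemma in_nbr u y : (y \in nbr u) = e u y.
Proof.
apply/common_nbrP/idP => [/(_ u (set11 u))//|euy x].
by rewrite inE => /eqP ->.
Qed.

Lemma max_cliquesP (S K : {set T}) :
  reflect [/\ K \subset S, is_clique e K
    & forall y, y \in S -> {in K, forall x, x != y -> e x y} -> y \in K]
    (K \in MC S).
Proof.
rewrite inE; apply: (iffP maxsetP) => [[/andP[KS Kc] Kmax]|[KS Kc Kmax]].
  split=> // y yS yK; rewrite -(Kmax (y |: K)) ?subsetU1 ?setU11 //.
  rewrite subUset sub1set yS KS /=; apply/is_cliqueP => a b.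
  rewrite !inE => /predU1P[->|aK] /predU1P[->|bK]; rewrite ?eqxx //.
  - by move=> yb; rewrite e_sym yK // eq_sym.
  - exact: yK.
  - exact: (is_cliqueP e K Kc).
split; first by rewrite KS.
move=> B /andP[BS /is_cliqueP Bc] KB; apply/eqP; rewrite eqEsubset KB andbT.
apply/subsetP => y yB; apply: Kmax; first exact: (subsetP BS).
by move=> x xK xy; apply: Bc => //; apply: (subsetP KB).
Qed.

Lemma max_cliques_set0 : #|MC set0| = 1.
Proof.
rewrite -(cards1 (set0 : {set T})); apply: eq_card => K; rewrite in_set1.
apply/max_cliquesP/eqP => [[]|->]; first by rewrite subset0 => /eqP.
split=> [||y]; rewrite ?sub0set ?inE //.
by apply/is_cliqueP => x y; rewrite inE.
Qed.

(** Once its trace [X] on [A] is fixed, [K] is determined by [K :\: A], which is maximal among the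
    vertices outside [A] adjacent to all of [X]. *)
Lemma max_cliques_meet (A X S : {set T}) :
  #|[set K in MC S | K :&: A == X]| <= #|MC ((S :\: A) :&: N X)|.
Proof.
rewrite -(@card_in_imset _ _ (fun K : {set T} => K :\: A)).
  apply/subset_leq_card/subsetP => _ /imsetP[K + ->].
  rewrite inE => /andP[/max_cliquesP[KS /is_cliqueP Kc Kmax] /eqP KX].
  have KXE x : (x \in X) = (x \in K) && (x \in A) by rewrite -KX inE.
  apply/max_cliquesP; split.
  - rewrite subsetI setSD //=; apply/subsetP => y; rewrite inE => /andP[yA yK].
    apply/common_nbrP => x; rewrite KXE => /andP[xK xA].
    by apply: Kc => //; apply: contraNneq yA => <-.
  - by apply/is_cliqueP => x y /setDP[xK _] /setDP[yK _]; apply: Kc.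
  - move=> y /setIP[/setDP[yS yA] /common_nbrP yX] yK; rewrite inE yA /=.
    apply: Kmax => // x xK xy; have [xA|xA] := boolP (x \in A).
      by apply: yX; rewrite KXE xK xA.
    by apply: yK; rewrite // inE xA.
move=> K K'; rewrite !inE => /andP[_ /eqP KX] /andP[_ /eqP KX'] KK'.
by rewrite -(setID K A) -(setID K' A) KX KX' KK'.
Qed.

Lemma max_cliques_at (S : {set T}) (u : T) :
  #|[set K in MC S | u \in K]| <= #|MC (S :&: nbr u)|.
Proof.
have -> : S :&: nbr u = (S :\: [set u]) :&: nbr u.
  apply/setP => x; rewrite !in_setI in_setD in_set1 in_nbr.
  by case: eqP => [->|]; rewrite ?e_irr ?andbF.
apply: leq_trans (max_cliques_meet _ _ _).
apply/subset_leq_card/subsetP => K; rewrite !in_set => /andP[-> uK] /=.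
by apply/eqP/setIidPr; rewrite sub1set.
Qed.

Lemma max_cliques_transversal (S Z : {set T}) :
    {in MC S, forall K : {set T}, exists2 u, u \in K & u \in Z} ->
  #|MC S| <= \sum_(u in Z) #|MC (S :&: nbr u)|.
Proof.
move=> hit.
apply: (@leq_trans (\sum_(u in Z) #|[set K in MC S | u \in K]|)).
  apply: leq_trans (card_bigcup_leq _ _).
  apply/subset_leq_card/subsetP => K KS.
  have [u uK uZ] := hit K KS.
  by apply/bigcupP; exists u => //; rewrite in_set KS.
by apply: leq_sum => u _; apply: max_cliques_at.
Qed.

(** A clique inside the neighbourhood of [v] could be extended by [v]. Since [v] is not its own
    neighbour, [v] itself may serve as [u]. *)
Lemma max_cliques_non_nbr (S : {set T}) (v : T) : v \in S ->
  {in MC S, forall K : {set T}, exists2 u, u \in K & u \in S :\: nbr v}.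
Proof.
move=> vS K /max_cliquesP[KS Kc Kmax].
have [[u /andP[uK uZ]]|no] := altP (@existsP T (fun u => (u \in K) && (u \in S :\: nbr v))).
  by exists u.
have vK : v \in K.
  apply: Kmax => // x xK xv; apply: contraR no => xvN; apply/existsP; exists x.
  by rewrite xK in_setD in_nbr e_sym xvN (subsetP KS).
by exists v => //; rewrite in_setD in_nbr e_irr vS.
Qed.

Lemma max_cliques_sum_nbr (S : {set T}) (v : T) : v \in S ->
  #|MC S| <= \sum_(u in S) #|MC (S :&: nbr u)|.
Proof.
move=> vS; apply: max_cliques_transversal => K KS.
by have [u uK /setDP[uS _]] := max_cliques_non_nbr vS KS; exists u.
Qed.

(** If [K :\ v] is still maximal, it determines [K]. Otherwise [v] is in [K] and some [u] outside
    [K] is adjacent to all of [K :\ v]; then [u] is not adjacent to [v], and [K :\ v] is maximal in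
    the common neighbourhood of [u] and [v]. *)
Lemma max_cliques_delete (S : {set T}) (v : T) : v \in S ->
  #|MC S| <= #|MC (S :\ v)|
    + \sum_(u in (S :\ v) :\: nbr v) #|MC ((S :&: nbr v) :&: nbr u)|.
Proof.
move=> vS.
pose P (K : {set T}) := K :\ v \in MC (S :\ v).
rewrite -(cardsID [set K | P K] (MC S)); apply: leq_add.
  rewrite -(@card_in_imset _ _ (fun K : {set T} => K :\ v)).
    by apply/subset_leq_card/subsetP => _ /imsetP[K + ->]; rewrite in_setI in_set => /andP[].
  (* When two maximal cliques agree off [v] and one contains [v], then [v] is adjacent to all of the
     other, which must contain it too. *)
  have aux K K' : K \in MC S -> K' \in MC S -> K :\ v = K' :\ v -> K \subset K'.
    move=> /max_cliquesP[KS /is_cliqueP Kc _] /max_cliquesP[_ _ Kmax] KK'.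
    have KE x : x != v -> (x \in K) = (x \in K').
      by move=> xv; move/setP/(_ x): KK'; rewrite !in_setD1 xv.
    apply/subsetP => x xK; have [xv|xv] := eqVneq x v; last by rewrite -KE.
    apply: Kmax; first exact: (subsetP KS).
    by move=> y yK' yx; apply: Kc; rewrite // KE // -xv.
  move=> K K'; rewrite !in_setI => /andP[KS _] /andP[KS' _] KK'.
  by apply/eqP; rewrite eqEsubset !aux.
apply: leq_trans (leq_trans (card_bigcup_leq ((S :\ v) :\: nbr v)
    (fun u => [set K in MC S | (v \in K) && (K :\ v \subset nbr u)])) _).
  apply/subset_leq_card/subsetP => K /setDP[KS]; rewrite in_set => nPK.
  have /max_cliquesP[KsS /is_cliqueP Kc Kmax] := KS.
  have Kvc : is_clique e (K :\ v).
    by apply/is_cliqueP => x y /setD1P[_ xK] /setD1P[_ yK]; apply: Kc.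
  have vK : v \in K.
    apply: contraR nPK => vK; apply/max_cliquesP; split=> //; first exact: setSD.
    move=> y /setD1P[yv yS] yK; rewrite in_setD1 yv /=; apply: Kmax => // x xK xy.
    by apply: yK => //; rewrite in_setD1 xK andbT; apply: contraNneq vK => <-.
  have [/existsP[u /and3P[uS uK /forall_inP uN]]|no] :=
    boolP [exists u, [&& u \in S :\ v, u \notin K & [forall x in K :\ v, e x u]]].
    apply/bigcupP; exists u.
      rewrite in_setD uS andbT in_nbr; apply: contra uK => evu.
      apply: Kmax => [|x xK _]; first by case/setD1P: uS.
      have [->//|xv] := eqVneq x v; by apply: uN; rewrite in_setD1 xv.
    rewrite in_set KS vK /=; apply/subsetP => x xK.
    by rewrite in_nbr e_sym uN.
  case/negP: nPK; apply/max_cliquesP; split=> //; first exact: setSD.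
  move=> y yS yK; apply: contraR no => yKv; apply/existsP; exists y.
  have yK' : y \notin K by move: yKv yS; rewrite !in_setD1; case: (y != v).
  rewrite yS yK' /=; apply/forall_inP => x xK; apply: yK => //.
  by apply: contraNneq yK' => <-; case/setD1P: xK.
apply: leq_sum => u _.
rewrite -(@card_in_imset _ _ (fun K : {set T} => K :\ v)).
  apply/subset_leq_card/subsetP => _ /imsetP[K + ->].
  rewrite in_set => /and3P[/max_cliquesP[KS /is_cliqueP Kc Kmax] vK Ku].
  apply/max_cliquesP; split.
  - rewrite !subsetI Ku andbT (subset_trans (subsetDl _ _)) //=.
    apply/subsetP => x /setD1P[xv xK]; rewrite in_nbr; apply: Kc => //.
    by rewrite eq_sym.
  - by apply/is_cliqueP => x y /setD1P[_ xK] /setD1P[_ yK]; apply: Kc.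
  - move=> y /setIP[/setIP[yS]]; rewrite in_nbr => evy _ yK.
    rewrite in_setD1; apply/andP; split.
      by apply: contraTneq evy => ->; rewrite e_irr.
    apply: Kmax => // x xK xy; have [->//|xv] := eqVneq x v.
    by apply: yK => //; rewrite in_setD1 xv.
move=> K K'; rewrite !in_set => /and3P[_ vK _] /and3P[_ vK' _] KK'.
by rewrite -(setD1K vK) -(setD1K vK') KK'.
Qed.

(** The vertex [v] is a common neighbour of [x] and [y] lying outside its own neighbourhood, so one
    common neighbour is lost. *)
Lemma closed_in_nbr c (S : {set T}) v : v \in S ->
  closed_in c.+1 e S -> closed_in c e (S :&: nbr v).
Proof.
move=> vS Sc x y /setIP[xS xv] /setIP[yS yv] xy exy.
rewrite -ltnS; apply: leq_trans (Sc x y xS yS xy exy).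
rewrite !in_nbr in xv yv.
rewrite !ltnS [X in _ < X](cardsD1 v) in_set vS e_sym xv e_sym yv /= add1n ltnS.
apply/subset_leq_card/subsetP => z.
rewrite in_set => /andP[/setIP[zS]]; rewrite in_nbr => evz /andP[exz eyz].
rewrite in_setD1 in_set zS exz eyz !andbT.
by apply: contraTneq evz => ->; rewrite e_irr.
Qed.

Lemma closed_in_sub c (S S' : {set T}) : S' \subset S ->
  closed_in c e S -> closed_in c e S'.
Proof.
move=> SS Sc x y xS yS xy exy.
apply: leq_ltn_trans (Sc x y (subsetP SS _ xS) (subsetP SS _ yS) xy exy).
apply/subset_leq_card/subsetP => z; rewrite !in_set => /andP[zS ->].
by rewrite (subsetP SS).
Qed.

Lemma closed_in0 (S : {set T}) : closed_in 0 e S -> #|MC S| = 1.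
Proof.
move=> Sc; rewrite -(cards1 S); apply: eq_card => K; rewrite in_set1.
have Sq x y : x \in S -> y \in S -> x != y -> e x y.
  by move=> xS yS xy; apply: contraT => /(Sc x y xS yS xy).
apply/max_cliquesP/eqP => [[KS _ Kmax]|->].
  apply/eqP; rewrite eqEsubset KS; apply/subsetP => y yS.
  by apply: Kmax => // x xK xy; apply: Sq => //; apply: (subsetP KS).
by split=> //; apply/is_cliqueP => x y; apply: Sq.
Qed.

(* A maximal clique avoiding v contains a non-neighbour u of v, so its trace X on
   A lies in the small set of common neighbours of u and v. *)
Lemma max_cliques_star (S : {set T}) (v : T) :
  let A := S :&: nbr v in let B := (S :\: A) :\ v in v \in S ->
  #|MC S| <= #|MC B :\ set0| + #|MC A|
    + \sum_(X in [set X in powerset A :\ set0 | B :&: N X != set0]) #|MC (B :&: N X)|.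
Proof.
move=> A B vS.
have BE x : x \in B = [&& x != v, x \in S & ~~ e v x].
  by rewrite /B /A !in_setD !in_setI !in_set1 in_nbr; case: (x \in S); rewrite ?andbT ?andbF.
(* Three classes: cliques through [v], cliques inside [B], and the rest, sorted by their trace on
   [A]. *)
rewrite -(cardsID [set K : {set T} | v \in K] (MC S)) (addnC #|MC B :\ set0|) -addnA.
apply: leq_add.
  by apply: leq_trans (max_cliques_at _ _); apply/subset_leq_card/subsetP => K; rewrite !in_set.
rewrite -(cardsID [set K : {set T} | K \subset B]); apply: leq_add.
  apply/subset_leq_card/subsetP => K /setIP[/setDP[+ vK]].
  rewrite in_set in vK; move=> /max_cliquesP[KS Kc Kmax]; rewrite inE => KB; rewrite in_setD1; apply/andP; split.
    by apply: contraNneq vK => K0; apply: Kmax => // x; rewrite K0 inE.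
  apply/max_cliquesP; split=> // y; rewrite BE => /and3P[_ yS _]; exact: Kmax.
apply: (@leq_trans (\sum_(X in [set X in powerset A :\ set0 | B :&: N X != set0])
   #|[set K in MC S | K :&: (v |: A) == X]|)); last first.
  apply: leq_sum => X _; apply: leq_trans (max_cliques_meet _ _ _) _.
  by rewrite /B setDDl setUC.
apply: leq_trans (card_bigcup_leq _ _); apply/subset_leq_card/subsetP => /= K.
case/setDP => /setDP[KMC]; rewrite !in_set => vK KB.
have /max_cliquesP[KS /is_cliqueP Kc Kmax] := KMC.
have KA : K :&: (v |: A) = K :&: A.
  by apply/setP => x; rewrite [LHS]in_setI [RHS]in_setI in_setU1; case: eqP => [->|//]; rewrite (negPf vK).
apply/bigcupP; exists (K :&: A); last by rewrite in_set KMC KA eqxx.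
rewrite in_set in_setD1 powersetE subsetIr andbT; apply/andP; split.
  move/subsetPn: KB => [x xK xB]; apply/set0Pn; exists x.
  have xS := subsetP KS x xK.
  move: xB; rewrite BE xS in_setI xK in_setI in_nbr xS negb_and !negbK /=.
  by case: eqP => [xv|_ //]; rewrite xv (negPf vK) in xK.
have [u /andP[uK /andP[uv nvu]]] : exists u, (u \in K) && ((u != v) && ~~ e v u).
  apply/existsP; apply: contraR vK => /existsPn no; apply: Kmax => // x xK xv.
  by have := no x; rewrite xK xv /= negbK e_sym.
apply/set0Pn; exists u; rewrite in_setI BE uv (subsetP KS) // nvu /=.
apply/common_nbrP => x /setIP[xK /setIP[_]]; rewrite in_nbr => evx.
by apply: Kc => //; apply: contraTneq evx => ->.
Qed.

(** Double counting of pairs [(X, u)] with [u] in [B] adjacent to all of [X]: as [u] and [v] are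
    nonadjacent, [X] is a subset of the at most [c] common neighbours of [u] and [v]. *)
Lemma sum_common_nbr c (S : {set T}) (v : T) :
  let A := S :&: nbr v in let B := (S :\: A) :\ v in
  v \in S -> closed_in c.+1 e S ->
  \sum_(X in [set X in powerset A :\ set0 | B :&: N X != set0]) #|B :&: N X|
    <= 2 ^ c * #|B|.
Proof.
move=> A B vS Sc.
apply: (@leq_trans (\sum_(X in powerset A) \sum_(u in B) (u \in N X))).
  apply: (@leq_trans (\sum_(X in powerset A) #|B :&: N X|)).
    rewrite [X in _ <= X](bigID (mem [set X in powerset A :\ set0 | B :&: N X != set0])) /=.
    apply: leq_trans (leq_addr _ _); rewrite leq_eqVlt; apply/orP; left; apply/eqP.
    apply: eq_bigl => X; apply/idP/andP => [XQ|[]//]; split=> //.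
    by move: XQ; rewrite in_set => /andP[/setD1P[]].
  by apply: leq_sum => X _; rewrite -sum1_card big_mkcond /= [X in _ <= X]big_mkcond /=;
     apply: leq_sum => u _; rewrite in_setI; case: (u \in B); case: (u \in N X).
rewrite exchange_big mulnC -sum_nat_const; apply: leq_sum => u uB.
move: uB; rewrite in_setD1 in_setD => /and3P[uv + uS].
rewrite in_setI uS in_nbr /= => nvu.
have : #|A :&: nbr u| <= c.
  rewrite eq_sym in uv; rewrite -ltnS; apply: leq_ltn_trans (Sc v u vS uS uv nvu).
  apply/subset_leq_card/subsetP => z; rewrite /A !in_setI !in_nbr in_set.
  by case/andP=> /andP[-> ->] ->.
move/(leq_pexp2l (isT : 0 < 2)); apply: leq_trans.
rewrite -card_powerset -big_mkcondr sum1_card /=; apply/subset_leq_card/subsetP => X.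
rewrite inE => /andP[]; rewrite !powersetE subsetI => -> /common_nbrP uX /=.
by apply/subsetP => x xX; rewrite in_nbr e_sym uX.
Qed.

End MaximalCliques.

(** * Encoding a maximal blow-up by one code per part *)

Section Blowups.

Variables (k : nat) (h : rel 'I_k) (U : {set 'I_k}) (T : finType) (e : rel T) (c : nat).
Hypothesis (graph_h : simple_graph h) (graph_e : simple_graph e) (closed_e : c_closed c e).

Lemma blowupP (S : {set T}) :
  reflect (exists V : {ffun 'I_k -> {set T}},
    [/\ indexed_partition V S,
        forall i j, h i j -> {in V i & V j, forall x y, e x y}
      & {in U, forall i, is_clique e (V i)}])
    (blowup h U e S).
Proof.
apply: (iffP existsP) => -[V]; last first.
  move=> [VS Vh VU]; exists V; rewrite VS /=; apply/andP; split.
    apply/forallP => i; apply/forallP => j; apply/implyP => hij.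
    by apply/forall_inP => x xi; apply/forall_inP => y yj; apply: Vh hij _ _ xi yj.
  by apply/forall_inP.
case/and3P=> VS /forallP Vh /forall_inP VU; exists V; split=> // i j hij x y xi yj.
by move: (Vh i) => /forallP/(_ j); rewrite hij => /forall_inP/(_ x xi)/forall_inP/(_ y yj).
Qed.

(** Otherwise adding [x] to the part [V i] would give a strictly larger blow-up. *)
Lemma max_blowup_absorb (S : {set T}) (V : {ffun 'I_k -> {set T}}) (i : 'I_k) (x : T) :
    S \in max_blowups h U e -> indexed_partition V S ->
    (forall i j, h i j -> {in V i & V j, forall x y, e x y}) ->
    {in U, forall i, is_clique e (V i)} ->
    (forall j, h i j -> {in V j, forall y, e x y}) ->
    (i \in U -> {in V i, forall y, x != y -> e x y}) ->
  x \in S.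
Proof.
rewrite inE => /maxsetP[_ Smax] /and3P[/forallP Vn0 /forallP Vd /eqP VS] Vh VU xh xU.
apply/negPn/negP => xS; case/negP: (xS).
rewrite -(Smax (x |: S)) ?setU11 ?subsetU1 //; apply/blowupP.
pose W := [ffun j => if j == i then x |: V i else V j].
have xV j : x \notin V j.
  by apply: contra xS => xj; rewrite -VS; apply/bigcupP; exists j.
exists W; split.
- apply/and3P; split.
  + apply/forallP => j; rewrite ffunE; case: ifP => // _.
    by apply/set0Pn; exists x; rewrite setU11.
  + apply/forallP => j; apply/forallP => l; apply/implyP => jl.
    have dV a b : a != b -> [disjoint V a & V b].
      by move=> ab; have /forallP/(_ b) := Vd a; rewrite ab.
    have dU a b : a != b -> [disjoint x |: V a & V b].
      move=> /dV; rewrite !disjoints_subset subUset => ->.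
      by rewrite sub1set inE xV.
    rewrite !ffunE; case: eqP => [ji|_]; case: eqP => [li|_]; last exact: dV.
    * by rewrite ji li eqxx in jl.
    * by rewrite -ji dU.
    * by rewrite disjoint_sym -li dU // eq_sym.
  + apply/eqP/setP => y; rewrite in_setU1 -VS; apply/bigcupP/idP => [[j _]|].
      rewrite ffunE; case: eqP => _; last by move=> yj; apply/orP; right; apply/bigcupP; exists j.
      by case/setU1P => [->|yi]; rewrite ?eqxx //; apply/orP; right; apply/bigcupP; exists i.
    case/predU1P => [->|/bigcupP[j _ yj]].
      by exists i => //; rewrite ffunE eqxx setU11.
    by exists j => //; rewrite ffunE; case: eqP yj => // -> yi; rewrite setU1r.
- move=> j l hjl y z; rewrite !ffunE.
  case: eqP => [ji|_]; case: eqP => [li|_].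
  + by move: hjl; rewrite ji li graph_h.2.
  + rewrite ji in hjl; case/setU1P => [->|yi] zl; first exact: xh hjl _ zl.
    exact: Vh hjl _ _ yi zl.
  + rewrite li in hjl => yj; case/setU1P => [->|zi]; last exact: Vh hjl _ _ yj zi.
    by rewrite graph_e.1; rewrite graph_h.1 in hjl; apply: xh hjl _ yj.
  + exact: Vh.
- move=> j jU; rewrite ffunE; case: eqP => [ji|_]; last exact: VU.
  rewrite ji in jU; apply/is_cliqueP => y z /setU1P[->|yi] /setU1P[->|zi].
  + by rewrite eqxx.
  + exact: xU.
  + by rewrite eq_sym graph_e.1; apply: xU.
  + by apply: (is_cliqueP e (V i)) => //; apply: VU.
Qed.

(* Code of a part: itself if it has fewer than c vertices, otherwise a maximal
   clique containing it if it is a clique, and set0 if it is not.  In the last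
   case all neighbouring parts are small, hence known from the code. *)
Definition part_codes : {set {set T}} :=
  [set A : {set T} | #|A| < c] :|: max_cliques e setT.

(** The code [set0] marks a large non-clique part; it is replaced by all common neighbours of the
    sets coded at the neighbouring indices. *)
Definition decode (D : {ffun 'I_k -> {set T}}) : {set T} :=
  \bigcup_i (if D i == set0
             then [set x | [forall j, h i j ==> [forall y in D j, e x y]]]
             else D i).

Lemma max_blowups_decode :
  0 < c -> max_blowups h U e \subset decode @: [set D in ffun_on (mem part_codes)].
Proof.
move=> c0; apply/subsetP => S SB.
have : blowup h U e S by move: SB; rewrite inE => /maxsetP[].
case/blowupP => V [VS Vh VU]; have /and3P[/forallP Vn0 _ /eqP VE] := VS.
have absorb := max_blowup_absorb SB VS Vh VU.
have ext (i : 'I_k) : is_clique e (V i) ->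
    {C : {set T} | maxset (fun A => (A \subset setT) && is_clique e A) C & V i \subset C}.
  move=> Vi; have [|C CM VC] := @maxset_exists _ (fun A => (A \subset setT) && is_clique e A) (V i).
    by rewrite subsetT.
  by exists C.
(* The default [set0] arises exactly when no maximal clique contains the large part [V i], that is,
   when [V i] is not a clique. *)
pose D : {ffun 'I_k -> {set T}} := [ffun i => if #|V i| < c then V i else
  odflt set0 [pick C in max_cliques e setT | V i \subset C]].
have DP (i : 'I_k) : [\/ (#|V i| < c) /\ D i = V i,
    [/\ c <= #|V i|, is_clique e (V i), D i \in max_cliques e setT & V i \subset D i]
  | [/\ c <= #|V i|, ~~ is_clique e (V i) & D i = set0]].
  rewrite ffunE; case: ltnP => Vi; first by constructor 1.
  case: pickP => [C /andP[CM VC]|no] /=.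
    constructor 2; split=> //.
    move: CM => /(max_cliquesP graph_e)[_ /is_cliqueP Cc _].
    by apply/is_cliqueP => x y xi yi; apply: Cc; apply: (subsetP VC).
  constructor 3; split=> //; apply/negP => Vc.
  have [C CM VC] := ext i Vc.
  by have := no C; rewrite inE CM VC.
(* Parts are nonempty, so the marker [set0] is unambiguous. *)
have D0 i : (D i == set0) = (c <= #|V i|) && ~~ is_clique e (V i).
  case: (DP i) => [[Vi ->]|[Vi Vc _ VD]|[-> -> ->]]; last exact: eqxx.
    by rewrite leqNgt Vi; apply/negbTE.
  rewrite Vc andbF; apply/negbTE; apply: contra (Vn0 i) => /eqP D0.
  by rewrite -subset0 -D0.
apply/imsetP; exists D.
  rewrite inE; apply/ffun_onP => i; rewrite /= in_setU inE.
  case: (DP i) => [[Vi ->]|[_ _ -> _]|[_ _ ->]]; rewrite ?Vi ?orbT //.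
  by rewrite cards0 c0.
have small_nbr i j : h i j -> ~~ is_clique e (V i) -> #|V j| < c.
  move=> hij; apply: contraR; rewrite -leqNgt => cj.
  apply/is_cliqueP => x y xi yi xy; apply: contraLR cj => nxy; rewrite -ltnNge.
  apply: leq_ltn_trans (closed_e xy nxy); apply/subset_leq_card/subsetP => z zj.
  by rewrite inE (Vh _ _ hij x z) // (Vh _ _ hij y z).
apply/eqP; rewrite eqEsubset; apply/andP; split; apply/subsetP => x.
  rewrite -VE => /bigcupP[i _ xi]; apply/bigcupP; exists i => //.
  case: ifPn => [|Di].
    rewrite D0 => /andP[_ nVi]; rewrite inE; apply/forallP => j; apply/implyP => hij.
    apply/forall_inP => y; case: (DP j) => [[_ ->] yj|[cj]|[_ _ ->]].
    - exact: Vh hij _ _ xi yj.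
    - by move: cj; rewrite leqNgt (small_nbr i j).
    - by rewrite inE.
  case: (DP i) => [[_ ->]|[_ _ _ VD]|[_ _ Di0]] //; first exact: (subsetP VD).
  by rewrite Di0 eqxx in Di.
case/bigcupP => i _; case: ifPn => [|Di].
  (* The neighbouring parts are small, so their codes are exact and [x] can join [V i]; as [V i] is
     not a clique, [i] is outside [U]. *)
  rewrite D0 => /andP[ci nVi]; rewrite inE => /forallP xD.
  apply: (absorb i) => [j hij y yj|iU]; last by rewrite VU in nVi.
  have Dj : D j = V j.
    have Vj := small_nbr i j hij nVi.
    by case: (DP j) => [[]//|[cj]|[cj]]; move: cj; rewrite leqNgt Vj.
  by have := xD j; rewrite hij Dj => /forall_inP/(_ y yj).
case: (DP i) => [[_ ->] xi|[ci Vc DM VD] xD|[_ _ Di0]].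
- by rewrite -VE; apply/bigcupP; exists i.
- have /(max_cliquesP graph_e)[_ /is_cliqueP Dc _] := DM.
  (* If [x] outside [S] were nonadjacent to a vertex [y] of a neighbouring part, all of [V i], at
     least [c] vertices, would be common neighbours of [x] and [y]. *)
  apply/negPn/negP => xS; case/negP: (xS).
  apply: (absorb i) => [j hij y yj|_ y yi xy]; last by apply: Dc => //; apply: (subsetP VD).
  have xy : x != y.
    by apply: contraNneq xS => ->; rewrite -VE; apply/bigcupP; exists j.
  apply: contraT => nxy; have := closed_e xy nxy; rewrite ltnNge => /negP[].
  apply: leq_trans ci _; apply/subset_leq_card/subsetP => z zi.
  rewrite inE (graph_e.1 y) (Vh _ _ hij z y) // andbT; apply: Dc => //.
    exact: (subsetP VD).
  by apply: contraNneq xS => ->; rewrite -VE; apply/bigcupP; exists i.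
- by rewrite Di0 eqxx in Di.
Qed.

Lemma card_max_blowups :
  0 < c -> #|max_blowups h U e| <= #|part_codes| ^ k.
Proof.
move=> c0; apply: leq_trans (subset_leq_card (max_blowups_decode c0)) _.
apply: leq_trans (leq_imset_card _ _) _.
by rewrite cardsE card_ffun_on card_ord.
Qed.

Lemma max_blowups_small : 1 < k -> #|T| < 2 -> max_blowups h U e = set0.
Proof.
move=> k2 T2; apply/setP => S; rewrite in_set0; apply/negbTE/negP.
rewrite inE => /maxsetP[/blowupP[V [/and3P[/forallP Vn0 /forallP Vd _] _ _]] _].
pose i : 'I_k := Ordinal (ltnW k2); pose j : 'I_k := Ordinal k2.
have /set0Pn[x xi] := Vn0 i; have /set0Pn[y yj] := Vn0 j.
have /forallP/(_ j)/= := Vd i => dij.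
have xy : x != y by apply: contraTneq yj => <-; rewrite (disjointFr dij xi).
by move: T2; rewrite ltnNge -cardsT (leq_trans _ (subset_leq_card (subsetT [set x; y]))) // cards2 xy.
Qed.

End Blowups.

(** * Counting the codes *)

(** Each such set is the range of an [m]-tuple: its enumeration padded by repeating one of its
    elements. *)
Lemma card_nonempty_small_sets (T : finType) (m : nat) :
  #|[set A : {set T} | 0 < #|A| <= m]| <= #|T| ^ m.
Proof.
rewrite -(card_tuple m T).
pose f (t : m.-tuple T) := [set x in t].
apply: leq_trans (leq_imset_card f (mem predT)).
apply/subset_leq_card/subsetP => A; rewrite inE => /andP[/card_gt0P[x xA] Am].
have sz : size (enum A ++ nseq (m - #|A|) x) == m.
  by rewrite size_cat size_nseq -cardE subnKC.
apply/imsetP; exists (Tuple sz) => //; apply/setP => y.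
rewrite inE [RHS](mem_cat y (enum A) (nseq (m - #|A|) x)) mem_enum mem_nseq.
by case: (eqVneq y x) => [->|]; rewrite ?xA ?andbF ?orbF.
Qed.

(** The summand 1 counts the empty set; for [c = 1] it is the only small set, hence the factor
    [(1 < c)]. *)
Lemma card_part_codes (T : finType) (e : rel T) (c : nat) : 0 < c ->
  #|part_codes e c| <= 1 + (1 < c) * #|T| ^ c.-1 + #|max_cliques e setT|.
Proof.
move=> c0; apply: leq_trans (leq_card_setU _ _) _; rewrite leq_add2r.
have -> : [set A : {set T} | #|A| < c] = set0 |: [set A : {set T} | 0 < #|A| <= c.-1].
  apply/setP => A; rewrite !inE card_gt0.
  case: eqVneq => [->|_] /=; first by rewrite cards0 c0.
  by rewrite -[in RHS]ltnS prednK.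
apply: leq_trans (leq_card_setU _ _) _; rewrite cards1 leq_add2l.
have [c1|c1] := ltnP 1 c; first by rewrite mul1n card_nonempty_small_sets.
have -> : c = 1 by lia.
rewrite mul0n leqn0 cards_eq0; apply/eqP/setP => A; rewrite !inE.
by case: #|A|.
Qed.

Local Open Scope ring_scope.

(** * Moon-Moser, quadratic and subquadratic bounds on maximal cliques *)

Section Bounds.

Variables (R : realType) (T : finType) (e : rel T).
Hypothesis graph_e : simple_graph e.

Local Notation MC := (max_cliques e).
Local Notation N := (common_nbr e).
Local Notation nbr u := (common_nbr e [set u]).

Lemma natr_le_powR3 (s : nat) : s%:R <= 3 `^ (s%:R / 3) :> R.
Proof.
have s3 : (s ^ 3 <= 3 ^ s)%N.
  (* The step from [s] to [s + 1] needs [(s + 1)^3 <= 3 s^3], true from [s = 3] on; smaller cases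
     are computed. *)
  elim: s => // -[|[|[|s]]] // IH; rewrite [leqRHS]expnS.
  by apply: leq_trans (leq_mul (leqnn 3) IH); rewrite !expnS !expn0; nia.
have : (s%:R ^+ 3) `^ (3^-1) <= (3 ^+ s) `^ (3^-1) :> R.
  apply: ge0_ler_powR; rewrite ?invr_ge0 ?nnegrE ?exprn_ge0 ?ler0n //.
  by rewrite -!natrX ler_nat.
rewrite -!powR_mulrn ?ler0n // -!powRrM divff ?pnatr_eq0 // powRr1 ?ler0n //.
Qed.

(** For [v] of maximum degree [d] in [S], every maximal clique contains one of the [z = |S| - d]
    non-neighbours of [v]. By induction each lies in at most [3^(d/3)] of them, and
    [z <= 3^(z/3)]. *)
Lemma moon_moser (S : {set T}) : #|MC S|%:R <= 3 `^ (#|S|%:R / 3) :> R.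
Proof.
have [m] := ubnP #|S|; elim: m S => // m IH S; rewrite ltnS => Sm.
have [->|[v0 v0S]] := set_0Vmem S.
  by rewrite (max_cliques_set0 graph_e) cards0 mul0r powRr0.
have [v vS vmax] := arg_maxnP (fun u => #|S :&: nbr u|) v0S.
have {}vS : v \in S := vS.
set Z := S :\: nbr v.
have SZ : (#|S| = #|S :&: nbr v| + #|Z|)%N by rewrite cardsID.
have Z0 : (0 < #|Z|)%N.
  by apply/card_gt0P; exists v; rewrite in_setD in_nbr graph_e.2.
have hit := max_cliques_transversal graph_e (max_cliques_non_nbr graph_e vS).
apply: (@le_trans _ _ (\sum_(u in Z) 3 `^ (#|S :&: nbr v|%:R / 3))).
  rewrite -(ler_nat R) natr_sum in hit; apply: le_trans hit _.
  apply: ler_sum => u /setDP[uS _].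
  have uv : (#|S :&: nbr u| <= #|S :&: nbr v|)%N by apply: vmax.
  apply: le_trans (IH _ _) _; first by lia.
  by apply: ler_powR; rewrite ?ler1n // ler_pM2r ?invr_gt0 ?ltr0n // ler_nat.
rewrite sumr_const -[leLHS]mulr_natl SZ natrD mulrDl [X in _ <= _ `^ X]addrC powRD ?pnatr_eq0 ?implybT //.
by apply: ler_wpM2r; [exact: powR_ge0|exact: natr_le_powR3].
Qed.

Lemma max_cliques_quadratic (c : nat) (S : {set T}) :
  (0 < c)%N -> closed_in c e S ->
  #|MC S|%:R <= 1 + 3 `^ ((c%:R - 1) / 3) * (#|S| * #|S|.-1)%:R :> R.
Proof.
move=> c0; set q := 3 `^ _.
have q0 : 0 <= q by apply: powR_ge0.
have [m] := ubnP #|S|; elim: m S => // m IH S; rewrite ltnS => Sm Sc.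
have [->|[v vS]] := set_0Vmem S.
  by rewrite (max_cliques_set0 graph_e) cards0 mul0n mulr0 addr0.
have Sv := cardsD1 v S; rewrite vS add1n in Sv.
have := max_cliques_delete graph_e vS.
rewrite -(ler_nat R) natrD natr_sum => /le_trans; apply.
apply: (@le_trans _ _ ((1 + q * (#|S :\ v| * #|S :\ v|.-1)%:R) + \sum_(u in S :\ v) q)).
  apply: lerD; first by apply: IH; [lia|apply: closed_in_sub Sc; apply: subsetDl].
  rewrite [leRHS](bigID (mem (nbr v))) /= addrC.
  rewrite [leLHS](eq_bigl (fun u => (u \in S :\ v) && (u \notin nbr v))); last first.
    by move=> u; rewrite in_setD andbC.
  apply: ler_wpDr; first by apply: sumr_ge0.
  apply: ler_sum => u /andP[/setD1P[uv uS]]; rewrite in_nbr => nvu.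
  apply: le_trans (moon_moser _) _; apply: ler_powR; first by rewrite ler1n.
  rewrite ler_pM2r ?invr_gt0 ?ltr0n // lerBrDr natr1 ler_nat.
  rewrite eq_sym in uv; have := Sc v u vS uS uv nvu.
  rewrite (_ : [set z in S | e v z && e u z] = S :&: nbr v :&: nbr u) //.
  by apply/setP => z; rewrite in_set !in_setI !in_nbr andbA.
rewrite sumr_const -[X in _ + X]mulr_natl Sv /= [X in _ + X]mulrC -addrA -mulrDr lerD2l ler_wpM2l //.
(* With [s = |S|], this is [(s - 1)(s - 2) + (s - 1) <= s (s - 1)]. *)
by rewrite -natrD ler_nat; case: #|_| => //= p; nia.
Qed.

(** The bound is in a real [m >= 1] above [|S|], so that it can be applied with [m] a square root
    and also covers empty [S]. *)
Definition max_cliques_bound (c : nat) (C a : R) : Prop :=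
  forall (S : {set T}) (m : R), 1 <= m -> #|S|%:R <= m -> closed_in c e S ->
  #|MC S|%:R <= C * m `^ a.

(** Neighbourhoods are 0-closed, hence cliques, so each vertex lies in at most one maximal
    clique. *)
Lemma max_cliques_bound1 : max_cliques_bound 1 1 1.
Proof.
move=> S m m1 Sm Sc; rewrite mul1r powRr1; last by lra.
have [->|[v vS]] := set_0Vmem S; first by rewrite (max_cliques_set0 graph_e).
apply: le_trans Sm; rewrite ler_nat -[leqRHS]sum1_card.
apply: leq_trans (max_cliques_sum_nbr graph_e vS) _.
by apply: leq_sum => u uS; rewrite closed_in0 //; apply: closed_in_nbr.
Qed.

(* Peel off closed neighbourhoods of maximum-degree vertices while that degree d
   exceeds sqrt n, at a cost O(n d^(a - 1)), i.e. O(n^(a / 2)) per removed vertex;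
   afterwards each vertex lies in O(sqrt n ^ a) maximal cliques. *)
Lemma max_cliques_boundS (c : nat) (C a : R) : 1 <= C -> 1 <= a <= 2 ->
  max_cliques_bound c C a ->
  max_cliques_bound c.+1 ((2 ^+ c + 2) * C) (1 + a / 2).
Proof.
move=> C1 /andP[a1 a2] F S0 n n1 S0n S0c.
have n0 : 0 < n by lra.
set p := n `^ (a / 2); have p1 : 1 <= p by rewrite -[leLHS](powRr0 n) ler_powR //; lra.
have P0 : 0 < 2 ^+ c :> R by apply: exprn_gt0.
have s1 : 1 <= n `^ (2^-1) by rewrite -[leLHS](powRr0 n) ler_powR // invr_ge0.
have sp : (n `^ (2^-1)) `^ a = p by rewrite -powRrM mulrC.
(* In the induction [n] and [p] stay fixed while [S] shrinks. At [S0] the additive 1 is absorbed by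
   one extra [C * p * n]. *)
suff: forall S : {set T}, #|S|%:R <= n -> closed_in c.+1 e S ->
    #|MC S|%:R <= 1 + (2 ^+ c + 1) * C * p * #|S|%:R.
  move=> /(_ S0 S0n S0c) /le_trans; apply.
  rewrite powRD; last by apply/implyP => _; lra.
  rewrite powRr1 -/p; last by lra.
  have : (2 ^+ c + 1) * C * p * #|S0|%:R <= (2 ^+ c + 1) * C * p * n.
    by apply: ler_wpM2l => //; rewrite !mulr_ge0 //; lra.
  have : 1 <= C * p * n by rewrite !mulr_ege1.
  by lra.
move=> S; have [m] := ubnP #|S|; elim: m S => // m IH S; rewrite ltnS => Sm Sn Sc.
have [->|[v0 v0S]] := set_0Vmem S.
  by rewrite (max_cliques_set0 graph_e) cards0 mulr0 addr0.
have [v vS vmax] := arg_maxnP (fun u => #|S :&: nbr u|) v0S.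
have {}vS : v \in S := vS.
set A := S :&: nbr v; set d := #|A|.
(* If no degree exceeds the square root of [n], the hypothesis [F] with [m = n^(1/2)] gives at most
   [C * p] maximal cliques per vertex. *)
have [dn|nd] := lerP d%:R (n `^ (2^-1)).
  have := max_cliques_sum_nbr graph_e vS.
  rewrite -(ler_nat R) natr_sum => /le_trans; apply.
  apply: (@le_trans _ _ (\sum_(u in S) C * p)).
    apply: ler_sum => u uS; rewrite -sp; apply: F => //.
      by apply: le_trans dn; rewrite ler_nat; apply: vmax.
    exact: closed_in_nbr.
  rewrite sumr_const -[leLHS]mulr_natr.
  have : 0 <= 2 ^+ c * (C * p * #|S|%:R) by rewrite !mulr_ge0 //; lra.
  by lra.
set B := (S :\: A) :\ v.
have vA : v \notin A by rewrite in_setI in_nbr graph_e.2 andbF.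
have AS : (#|S| = d + #|B|.+1)%N.
  rewrite -(cardsID A S) (setIidPr (subsetIl _ _)) (cardsD1 v (S :\: A)) -/B.
  by rewrite in_setD vS vA.
have BS : B \subset S by rewrite /B; apply: subset_trans (subsetDl _ _) (subsetDl _ _).
have Bn : #|B|%:R <= n by apply: le_trans Sn; rewrite ler_nat subset_leq_card.
have d1 : 1 <= d%:R :> R by lra.
have dn0 : d%:R != 0 :> R by rewrite gt_eqF //; lra.
have nn0 : n != 0 by rewrite gt_eqF.
have dSn : d%:R <= n by apply: le_trans Sn; rewrite ler_nat AS leq_addr.
set D := d%:R `^ (a - 1).
(* Since [a - 2 <= 0] and [d] exceeds the square root of [n], [n d^(a-2) <= n n^((a-2)/2) = p]. *)
have key : n * D <= d%:R * p.
  have -> : n * D = d%:R * (n * d%:R `^ (a - 2)).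
    rewrite mulrCA /D; congr (_ * _).
    have {1}-> : a - 1 = 1 + (a - 2) by lra.
    by rewrite [LHS]powRD ?dn0 ?implybT // powRr1 // ler0n.
  apply: ler_wpM2l; first by lra.
  have -> : p = n * (n `^ (2^-1)) `^ (a - 2).
    rewrite -powRrM -[X in X * _](powRr1 (ltW n0)) -powRD ?nn0 ?implybT //.
    by congr (_ `^ _); lra.
  apply: ler_wpM2l; first exact: ltW.
  have [b b0 ->] : exists2 b : R, 0 <= b & a - 2 = - b by exists (2 - a); lra.
  rewrite !powRN lef_pV2 ?posrE ?powR_gt0 //; last by lra.
  by apply: ge0_ler_powR; rewrite ?nnegrE; lra.
have := max_cliques_star graph_e vS; rewrite -/A -/B.
rewrite -(ler_nat R) 2!natrD natr_sum => /le_trans; apply.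
have hB : #|MC B :\ set0|%:R <= 1 + (2 ^+ c + 1) * C * p * #|B|%:R.
  apply: le_trans (IH B _ _ _) => //.
  - by rewrite ler_nat subset_leq_card ?subsetDl.
  - by apply: leq_trans Sm; rewrite AS leq_addl.
  - exact: closed_in_sub Sc.
have hA : #|MC A|%:R <= C * (d%:R * p).
  apply: le_trans (F A d%:R d1 (lexx _) (closed_in_nbr graph_e vS Sc)) _.
  apply: ler_wpM2l; first by lra.
  apply: le_trans key; rewrite -mulr_powRB1; [|by lra..].
  by apply: ler_wpM2r; [exact: powR_ge0|].
set Q := [set X in _ | _].
(* Each [B :&: N X] lies in the neighbourhood of some [x] in [X], so its size [b] is at most [d] and
   [b^a <= D b]; the sizes sum to at most [2^c n]. *)
have hX : \sum_(X in Q) #|MC (B :&: N X)|%:R <= 2 ^+ c * C * (d%:R * p).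
  apply: (@le_trans _ _ (\sum_(X in Q) C * D * #|B :&: N X|%:R)).
    apply: ler_sum => X; rewrite in_set in_setD1 powersetE => /andP[/andP[X0 XA]].
    rewrite -card_gt0 => b0; move/set0Pn: X0 => [x xX].
    have /setIP[xS _] := subsetP XA x xX.
    have bsub : B :&: N X \subset S :&: nbr x.
      apply: setISS => //; apply/subsetP => y /common_nbrP/(_ x xX).
      by rewrite in_nbr.
    have b1 : 1 <= #|B :&: N X|%:R :> R by rewrite ler1n.
    apply: le_trans (F _ _ b1 (lexx _) _) _.
      exact: closed_in_sub bsub (closed_in_nbr graph_e xS Sc).
    rewrite -mulrA; apply: ler_wpM2l; first by lra.
    rewrite -mulr_powRB1 ?ler0n //; last by lra.
    rewrite mulrC; apply: ler_wpM2r => //.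
    apply: ge0_ler_powR; rewrite ?nnegrE ?ler0n ?subr_ge0 //.
    by rewrite ler_nat; apply: leq_trans (subset_leq_card bsub) (vmax x xS).
  rewrite -mulr_sumr -natr_sum.
  have := sum_common_nbr graph_e vS Sc; rewrite -/A -/B -/Q.
  rewrite -(ler_nat R) natrM natrX => hQ.
  have hQ' : (\sum_(X in Q) #|B :&: N X|)%:R <= 2 ^+ c * n.
    by apply: le_trans hQ _; rewrite ler_pM2l.
  have D0 : 0 <= D by apply: powR_ge0.
  apply: (@le_trans _ _ (C * D * (2 ^+ c * n))).
    by apply: ler_wpM2l => //; rewrite mulr_ge0 //; lra.
  have -> : C * D * (2 ^+ c * n) = 2 ^+ c * C * (n * D) by ring.
  by apply: ler_wpM2l => //; rewrite mulr_ge0 //; lra.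
have CP : 0 <= (2 ^+ c + 1) * C * p by rewrite !mulr_ge0 //; lra.
(* The cost [(2^c + 1) C d p] of [hA] and [hX] is charged to the [d] removed vertices of [A]. *)
rewrite AS natrD -natr1; lra.
Qed.

(** The map [a -> 1 + a / 2] halves the distance of [a] to 2; that distance is 1 at [c = 1], hence
    [2^(1-c)]. *)
Lemma max_cliques_subquadratic (c : nat) : (0 < c)%N ->
  max_cliques_bound c (4 `^ ((c%:R + 4) * (c%:R - 1) / 2)) (2 - 2 `^ (1 - c%:R)).
Proof.
case: c => // c _; elim: c => [|c IH].
  rewrite subrr mulr0 mul0r !powRr0 (_ : 2 - 1 = 1); last by lra.
  exact: max_cliques_bound1.
set a := 2 - 2 `^ (1 - c.+1%:R) in IH.
have aE : 2 `^ (1 - c.+1%:R) = 2 ^- c :> R.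
  by rewrite -powR_invn // -[c.+1]addn1 natrD opprD addrCA subrr addr0.
have -> : 2 - 2 `^ (1 - c.+2%:R) = 1 + a / 2.
  rewrite /a aE (_ : 1 - c.+2%:R = - c.+1%:R :> R); last by rewrite -(natr1 c.+1); lra.
  by rewrite powR_invn // exprS invfM; lra.
have [a1 a2] : 1 <= a /\ a <= 2.
  have : 0 <= 2 ^- c :> R by rewrite invr_ge0 exprn_ge0.
  have : 2 ^- c <= 1 :> R by rewrite invf_le1 ?exprn_gt0 // exprn_ege1 // ler1n.
  by rewrite /a aE => h1 h2; split; lra.
set C := 4 `^ _ in IH.
have C1 : 1 <= C.
  rewrite -[leLHS](powRr0 4) ler_powR ?ler1n // divr_ge0 //.
  by rewrite mulr_ge0 ?subr_ge0 ?ler1n ?addr_ge0 ?ler0n.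
have := max_cliques_boundS C1 (introT andP (conj a1 a2)) IH.
move=> H S m m1 Sm Sc; apply: le_trans (H S m m1 Sm Sc) _.
apply: ler_wpM2r; first exact: powR_ge0.
(* The two exponents of 4 differ by [c + 3], and the recursion factor [2^(c+1) + 2] is at most
   [4^(c+3)]. *)
have -> : 4 `^ ((c.+2%:R + 4) * (c.+2%:R - 1) / 2) = 4 ^+ c.+3 * C :> R.
  rewrite /C -powR_mulrn // -powRD ?pnatr_eq0 ?implybT //; congr (_ `^ _).
  by rewrite -(natr1 c.+2) -(natr1 c.+1); field.
apply: ler_wpM2r; first by lra.
have : 2 ^+ c.+1 <= 4 ^+ c.+1 :> R by apply: lerXn2r; rewrite ?nnegrE; lra.
have : 1 <= 4 ^+ c.+1 :> R by rewrite exprn_ege1 // ler1n.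
by rewrite (exprS _ c.+2) (exprS _ c.+1); lra.
Qed.

End Bounds.

(** * From maximal cliques to maximal blow-ups *)

Lemma max_blowups_bound (R : realType) (k : nat) (h : rel 'I_k) (U : {set 'I_k})
    (c : nat) (T : finType) (e : rel T) (M : R) :
    (1 < k)%N -> (0 < c)%N -> simple_graph h -> simple_graph e -> c_closed c e ->
    (1 < #|T|)%N -> 2 <= M -> ((1 < c)%N -> 3 <= M) ->
    #|max_cliques e setT|%:R <= M ->
  #|max_blowups h U e|%:R <= (#|T|%:R ^+ maxn (c - 1) 1 * M) ^+ k.
Proof.
move=> k2 c0 graph_h graph_e closed_e n2 M2 M3 MCM.
have := card_max_blowups U graph_h graph_e closed_e c0.
rewrite -(ler_nat R) natrX => /le_trans; apply.
have n2R : 2 <= #|T|%:R :> R by rewrite ler_nat.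
apply: lerXn2r; rewrite ?nnegrE ?ler0n //.
  by rewrite mulr_ge0 ?exprn_ge0 ?ler0n //; lra.
have := card_part_codes e c0; rewrite -(ler_nat R) => /le_trans; apply.
(* For [c > 1], [1 + X + M <= X M] is [(X - 1)(M - 1) >= 2], which holds as [X >= 2] and [M >= 3].
   For [c = 1], [1 + M <= n M] suffices. *)
rewrite !natrD natrM natrX; case: (ltnP 1 c) => c1.
  rewrite -subn1 (maxn_idPl _) ?subn_gt0 // mul1r.
  have := M3 c1; set X := _ ^+ _ => M3'.
  have X2 : 2 <= X.
    apply: (le_trans n2R); rewrite -[leLHS]expr1.
    by apply: ler_weXn2l; [lra|rewrite subn_gt0].
  by nra.
have -> : maxn (c - 1) 1 = 1%N by lia.
by rewrite expr1 mul0r; nra.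
Qed.

Theorem theorem2 (R : realType)
    (k : nat) (hk : (2 <= k)%N)
    (h : rel 'I_k) (hH : simple_graph h) (U : {set 'I_k})
    (c : nat) (hc : (1 <= c)%N)
    (n : nat) (T : finType) (hn : #|T| = n)
    (e : rel T) (hG : simple_graph e) (hcl : c_closed c e) :
  #|max_blowups h U e|%:R <=
    (n%:R : R) ^+ (maxn (c - 1) 1 * k) *
    Num.min
      (3 `^ ((c%:R - 1) * k%:R / 3) * n%:R ^+ (2 * k))
      (4 `^ ((c%:R + 4) * (c%:R - 1) * k%:R / 2)
         * n%:R `^ ((2 - 2 `^ (1 - c%:R)) * k%:R)).
Proof.
(* Two disjoint nonempty parts need two vertices, so for [n < 2] there is nothing to count. *)
have [n2|n2] := ltnP n 2.
  rewrite (max_blowups_small h U e hk) ?hn // cards0.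
  rewrite mulr_ge0 ?exprn_ge0 // le_min.
  by rewrite !mulr_ge0 ?exprn_ge0 ?powR_ge0.
have n2R : 2 <= n%:R :> R by rewrite ler_nat.
have clT : closed_in c e setT.
  move=> x y _ _ xy nxy; apply: leq_trans (hcl x y xy nxy).
  by rewrite ltnS; apply/subset_leq_card/subsetP => z; rewrite !inE.
have c1 : 0 <= c%:R - 1 :> R by rewrite subr_ge0 ler1n.
(* [M1] and [M2] are the [k]-th roots of the two terms of the minimum; each bounds the number of
   maximal cliques. *)
set M1 := 3 `^ ((c%:R - 1) / 3) * n%:R ^+ 2 : R.
set a := 2 - 2 `^ (1 - c%:R) : R.
set M2 := 4 `^ ((c%:R + 4) * (c%:R - 1) / 2) * n%:R `^ a : R.
have q1 : 1 <= 3 `^ ((c%:R - 1) / 3) :> R.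
  by rewrite -[leLHS](powRr0 3) ler_powR ?ler1n // divr_ge0.
have a1 : 1 <= a.
  have : 2 `^ (1 - c%:R) <= 2 `^ 0 :> R by rewrite ler_powR ?ler1n //; lra.
  by rewrite powRr0 /a; lra.
have na : 2 <= n%:R `^ a.
  by apply: (le_trans n2R); rewrite le1r_powR //; lra.
have n4 : 4 <= n%:R ^+ 2 :> R by rewrite expr2; nra.
have C1 : 1 <= 4 `^ ((c%:R + 4) * (c%:R - 1) / 2) :> R.
  rewrite -[leLHS](powRr0 4) ler_powR ?ler1n // divr_ge0 //.
  by rewrite mulr_ge0 // addr_ge0.
have -> : 3 `^ ((c%:R - 1) * k%:R / 3) * n%:R ^+ (2 * k) = M1 ^+ k.
  by rewrite exprMn exprM -[X in _ = X * _]powR_mulrn ?powR_ge0 // -powRrM mulrAC.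
have -> : 4 `^ ((c%:R + 4) * (c%:R - 1) * k%:R / 2) * n%:R `^ (a * k%:R) = M2 ^+ k.
  rewrite exprMn -[X in _ = X * _]powR_mulrn ?powR_ge0 //.
  by rewrite -[X in _ = _ * X]powR_mulrn ?powR_ge0 // -!powRrM mulrAC.
rewrite exprM; set X := n%:R ^+ _.
have [M1M|M2M] := leP (M1 ^+ k) (M2 ^+ k); rewrite -exprMn /X -hn.
  apply: max_blowups_bound; rewrite ?hn //; rewrite -?hn.
  - by rewrite /M1; nra.
  - by move=> _; rewrite /M1; nra.
  - apply: le_trans (max_cliques_quadratic R hG hc clT) _.
    (* With [q] the power of 3, [1 + q n (n - 1) <= q n^2] because [q n >= 1]. *)
    rewrite cardsT hn /M1; case: (n) n2R => [|p _] /=; first by lra.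
    by rewrite natrM -(natr1 p); have := ler0n R p; move: q1; nra.
apply: max_blowups_bound; rewrite ?hn //.
- by rewrite /M2; nra.
- move=> c2; have c2R : 2 <= c%:R :> R by rewrite ler_nat.
  have : 4 <= 4 `^ ((c%:R + 4) * (c%:R - 1) / 2) :> R by rewrite le1r_powR //; nra.
  by rewrite /M2; nra.
- apply: (max_cliques_subquadratic hG hc); rewrite ?cardsT ?hn //; lra.
Qed.
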